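(* Let $H$ be a bialgebra over a field $K$, let $A$ be an $H$-module-algebra with action map $\lambda$, and let $\Lambda_t=\sum_{i=0}^\infty\lambda_it^i$ be a deformation of $A$. Then $\lambda_1\in\mathcal{F}^1(A)$ is a $1$-cocycle (i.e. $d^1\lambda_1=0$) whose cohomology class in $H^1(\mathcal{F}^\bullet(A))$ is determined by the equivalence class of $\Lambda_t$ (that is, equivalent deformations have cohomologous infinitesimals). Moreover, if $\lambda_1=\cdots=\lambda_k=0$, then $\lambda_{k+1}$ is a $1$-cocycle in $\mathcal{F}^1(A)$.
   Context: Fix a field $K$; $\otimes$ and $\mathrm{Hom}$ are over $K$. $(H,\mu_H,\Delta_H)$ is a $K$-bialgebra; Sweedler notation $\Delta_H(x)=\sum_{(x)} x_{(1)}\otimes x_{(2)}$. $\mathrm{End}(A)$ is the algebra of $K$-linear endomorphisms of $A$. An associative $K$-algebra $A$ is an $H$-module-algebra if it has an $H$-module structure $\lambda\in\mathrm{Hom}(H,\mathrm{End}(A))$ with $\lambda(xy)=\lambda(x)\circ\lambda(y)$ and $\lambda(x)(ab)=\sum_{(x)}\lambda(x_{(1)})(a)\cdot\lambda(x_{(2)})(b)$ for $x,y\in H$, $a,b\in A$. $\mathrm{Der}(A)$ is the space of derivations $\varphi:A\to A$. Low degrees of the cochain complex $\mathcal{F}^\bullet(A)$: $\mathcal{F}^0(A)=\mathrm{Der}(A)$, $\mathcal{F}^1(A)=\mathrm{Hom}(H,\mathrm{End}(A))$, $\mathcal{F}^2(A)=\mathrm{Hom}(H^{\otimes2},\mathrm{End}(A))\oplus\mathrm{Hom}(H,\mathrm{Hom}(A^{\otimes2},A))$;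 $(d^0\varphi)(x)=\lambda(x)\circ\varphi-\varphi\circ\lambda(x)$; $d^1\psi=(d^1_0\psi;d^1_1\psi)$ with $$(d^1_0\psi)(x\otimes y)=\lambda(x)\circ\psi(y)-\psi(xy)+\psi(x)\circ\lambda(y),$$ $$(d^1_1\psi)(x)(a\otimes b)=\sum_{(x)}\lambda(x_{(1)})(a)\cdot\psi(x_{(2)})(b)-\psi(x)(ab)+\sum_{(x)}\psi(x_{(1)})(a)\cdot\lambda(x_{(2)})(b).$$ $H^1(\mathcal{F}^\bullet(A))=\ker d^1/\mathrm{im}\,d^0$. A deformation of $A$ is a power series $\Lambda_t=\sum_{i\ge0}\lambda_it^i$ with $\lambda_0=\lambda$, each $\lambda_i\in\mathcal{F}^1(A)$, satisfying $\Lambda_t(xy)=\Lambda_t(x)\circ\Lambda_t(y)$ and $\Lambda_t(x)(ab)=\sum_{(x)}\Lambda_t(x_{(1)})(a)\cdot\Lambda_t(x_{(2)})(b)$ for all $x,y\in H$, $a,b\in A$ (as identities of power series in $t$). Its infinitesimal is $\lambda_1$. A formal automorphism of $A$ is a power series $\Phi_t=\sum_{i\ge0}\phi_it^i$ with $\phi_0=\mathrm{Id}_A$, each $\phi_i\in\mathrm{End}(A)$, and $\Phi_t(ab)=\Phi_t(a)\Phi_t(b)$ for all $a,b\in A$. Deformations $\Lambda_t$, $\overline{\Lambda}_t$ are equivalent if $\overline{\Lambda}_t=\Phi_t^{-1}\Lambda_t\Phi_t$ for some formal automorphism $\Phi_t$, where $(\phi_i\lambda_j\phi_k)(x)=\phi_i\circ\lambda_j(x)\circ\phi_k$.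 *)

(* Defs.v *)
From HB Require Import structures.
From mathcomp Require Import all_boot all_algebra.
From mathcomp Require Import boolp.
From mathcomp Require Import freeg.

Set Implicit Arguments.
Unset Strict Implicit.
Unset Printing Implicit Defensive.

Import GRing.Theory.
Local Open Scope ring_scope.
Local Open Scope quotient_scope.

Section LinearMaps.
Variables (K : fieldType) (U V : lmodType K).
Implicit Types f g h : {linear U -> V}.

Definition mklinear (f : U -> V) (lin_f : linear f) : {linear U -> V} :=
  HB.pack f (GRing.isLinear.Build K U V *:%R f lin_f).

Lemma linear_ext f g : f =1 g -> f = g.
Proof.
move=> /funext; case: f => f [[fD] [fZ]]; case: g => g [[gD] [gZ]] /= fg.
subst g; congr (GRing.Linear.Pack (GRing.Linear.Class _ _));
  by congr (_ _); apply: Prop_irrelevance.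
Qed.

(* Spaces of linear maps are infinite-dimensional here, so ['Hom(U, V)] of    *)
(* [vector] does not apply; their module structure is set up directly.        *)
HB.instance Definition _ := gen_eqMixin {linear U -> V}.
HB.instance Definition _ := gen_choiceMixin {linear U -> V}.

Lemma linear0_subproof : linear (fun _ : U => 0 : V).
Proof. by move=> a u v; rewrite scaler0 addr0. Qed.

Lemma linearN_subproof f : linear (fun u => - f u).
Proof. by move=> a u v; rewrite linearP opprD scalerN. Qed.

Lemma linearD_subproof f g : linear (fun u => f u + g u).
Proof. by move=> a u v; rewrite !linearP scalerDr addrACA. Qed.

Lemma linearZ_subproof (c : K) f : linear (fun u => c *: f u).
Proof. by move=> a u v; rewrite linearP scalerDr !scalerA mulrC. Qed.

Definition lin0 := mklinear linear0_subproof.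
Definition linN f := mklinear (linearN_subproof f).
Definition linD f g := mklinear (linearD_subproof f g).
Definition linZ c f := mklinear (linearZ_subproof c f).

Lemma linDA : associative linD.
Proof. by move=> f g h; apply: linear_ext => u /=; rewrite addrA. Qed.
Lemma linDC : commutative linD.
Proof. by move=> f g; apply: linear_ext => u /=; rewrite addrC. Qed.
Lemma lin0D : left_id lin0 linD.
Proof. by move=> f; apply: linear_ext => u /=; rewrite add0r. Qed.
Lemma linND : left_inverse lin0 linN linD.
Proof. by move=> f; apply: linear_ext => u /=; rewrite addNr. Qed.

HB.instance Definition _ :=
  GRing.isZmodule.Build {linear U -> V} linDA linDC lin0D linND.

Lemma linZA a b f : linZ a (linZ b f) = linZ (a * b) f.
Proof. by apply: linear_ext => u /=; rewrite scalerA. Qed.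
Lemma lin1Z : left_id 1 linZ.
Proof. by move=> f; apply: linear_ext => u /=; rewrite scale1r. Qed.
Lemma linZDr : right_distributive linZ +%R.
Proof. by move=> a f g; apply: linear_ext => u /=; rewrite scalerDr. Qed.
Lemma linZDl f : {morph linZ^~ f : a b / a + b}.
Proof. by move=> a b; apply: linear_ext => u /=; rewrite scalerDl. Qed.

HB.instance Definition _ :=
  GRing.Zmodule_isLmodule.Build K {linear U -> V} linZA lin1Z linZDr linZDl.

Lemma lin0E u : (0 : {linear U -> V}) u = 0. Proof. by []. Qed.
Lemma linNE f u : (- f) u = - f u. Proof. by []. Qed.
Lemma linDE f g u : (f + g) u = f u + g u. Proof. by []. Qed.
Lemma linBE f g u : (f - g) u = f u - g u. Proof. by []. Qed.
Lemma linZE c f u : (c *: f) u = c *: f u. Proof. by []. Qed.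
Lemma lin_sumE I (r : seq I) (P : pred I) (F : I -> {linear U -> V}) u :
  (\sum_(i <- r | P i) F i) u = \sum_(i <- r | P i) F i u.
Proof. by elim/big_rec2: _ => //= i v f _ <-. Qed.

Definition linearE := (lin0E, linNE, linDE, linBE, linZE, lin_sumE).

End LinearMaps.

Definition mkbilinear (K : fieldType) (U V W : lmodType K) (f : U -> V -> W)
    (bilin_f : bilinear_for *:%R *:%R f) : {bilinear U -> V -> W} :=
  HB.pack f (bilinear_isBilinear.Build K U V W *:%R *:%R f bilin_f).

Notation End A := {linear A -> A}.

Definition idEnd (K : fieldType) (A : lmodType K) : End A := idfun.
Arguments idEnd {K A}.

Definition comp_lin (K : fieldType) (U V W : lmodType K)
  (f : {linear V -> W}) (g : {linear U -> V}) : {linear U -> W} := f \o g.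

Section QuotientModule.
Variables (K : fieldType) (V : lmodType K).
Variables (W : {pred V}) (W_submod : submod_closed W).

Definition submod_zmodClosed : zmodClosed V :=
  HB.pack_for (zmodClosed V) (W : V -> bool)
    (GRing.isZmodClosed.Build V W (GRing.submod_closedB W_submod)).

Definition quotmod := Quotient.quot submod_zmodClosed.

HB.instance Definition _ := GRing.Zmodule.on quotmod.

Definition quot_scale (a : K) (x : quotmod) : quotmod :=
  \pi_(quotmod) (a *: repr x).

Definition quot_class (v : V) : quotmod := \pi_(quotmod) v.

Lemma quot_classP u v : quot_class u = quot_class v <-> u - v \in W.
Proof.
rewrite /quot_class; have := Quotient.idealrBE submod_zmodClosed u v.
by rewrite -topredE /= => ->; split=> [->|/eqP].
Qed.

Lemma quot_reprK (x : quotmod) : quot_class (repr x) = x.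
Proof. exact: reprK. Qed.

Lemma quot_classD u v : quot_class (u + v) = quot_class u + quot_class v.
Proof. exact: (raddfD (\pi_(quotmod))). Qed.

Lemma quot_scaleE a v : quot_scale a (quot_class v) = quot_class (a *: v).
Proof.
apply/quot_classP; rewrite -scalerBr -[_ *: _]addr0.
apply: W_submod.2; last exact: W_submod.1.
by apply/quot_classP; apply: quot_reprK.
Qed.

Lemma quot_scaleA a b x : quot_scale a (quot_scale b x) = quot_scale (a * b) x.
Proof. by rewrite -[x]quot_reprK !quot_scaleE scalerA. Qed.
Lemma quot_scale1 : left_id 1 quot_scale.
Proof. by move=> x; rewrite -[x]quot_reprK quot_scaleE scale1r. Qed.
Lemma quot_scaleDr : right_distributive quot_scale +%R.
Proof.
move=> a x y; rewrite -[x]quot_reprK -[y]quot_reprK.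
by rewrite -quot_classD !quot_scaleE scalerDr quot_classD.
Qed.
Lemma quot_scaleDl x : {morph quot_scale^~ x : a b / a + b}.
Proof.
move=> a b; rewrite -[x]quot_reprK !quot_scaleE.
by rewrite scalerDl quot_classD.
Qed.

HB.instance Definition _ := GRing.Zmodule_isLmodule.Build K quotmod
  quot_scaleA quot_scale1 quot_scaleDr quot_scaleDl.

Lemma quot_class_linear : linear quot_class.
Proof. by move=> a u v; rewrite quot_classD -quot_scaleE. Qed.
HB.instance Definition _ :=
  GRing.isLinear.Build K V quotmod *:%R quot_class quot_class_linear.

End QuotientModule.

Section TensorProduct.
Variables (K : fieldType) (U V : lmodType K).

Local Notation freeUV := {freeg (U * V)%type / K}.
Local Notation gen u v := (<< (u, v) >> : freeUV).

(* The tensor product is the free module on pairs modulo the submodule       *)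
(* spanned by the bilinearity relations.                                      *)
Inductive tensor_rel : freeUV -> Prop :=
| TensorRel0 : tensor_rel 0
| TensorRelP a x y : tensor_rel x -> tensor_rel y -> tensor_rel (a *: x + y)
| TensorRelL a u u' v :
    tensor_rel (gen (a *: u + u') v - (a *: gen u v + gen u' v))
| TensorRelR a u v v' :
    tensor_rel (gen u (a *: v + v') - (a *: gen u v + gen u v')).

Definition tensor_ker : {pred freeUV} := fun x => `[< tensor_rel x >].

Lemma tensor_ker_submod : submod_closed tensor_ker.
Proof.
split=> [|a x y /asboolP rx /asboolP ry]; apply/asboolP.
  exact: TensorRel0.
exact: TensorRelP.
Qed.
Definition tensor : lmodType K := quotmod tensor_ker_submod.

Definition tpure (u : U) (v : V) : tensor := quot_class tensor_ker_submod (gen u v).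

Lemma tpure_bilinear : bilinear_for *:%R *:%R tpure.
Proof.
split=> [v a u u'|u a v v']; rewrite /tpure -linearP; apply/quot_classP.
  apply/asboolP; exact: TensorRelL.
apply/asboolP; exact: TensorRelR.
Qed.
HB.instance Definition _ :=
  bilinear_isBilinear.Build K U V tensor *:%R *:%R tpure tpure_bilinear.

Section Lift.
Variables (W : lmodType K) (f : {bilinear U -> V -> W}).

Let lift0 : freeUV -> W := fglift (fun p => f p.1 p.2).

Let lift0U u v : lift0 (gen u v) = f u v.
Proof. by rewrite /lift0 liftU scale1r. Qed.

Let lift0B x y : lift0 (x - y) = lift0 x - lift0 y.
Proof. exact: lift_is_additive. Qed.

Let lift00 : lift0 0 = 0.
Proof. by rewrite -(subrr 0) lift0B subrr. Qed.

Let lift0D x y : lift0 (x + y) = lift0 x + lift0 y.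
Proof. by rewrite -[y in LHS]opprK -[- y]add0r !lift0B lift00 sub0r opprK. Qed.

Let lift0_sum (I : Type) (r : seq I) (F : I -> freeUV) :
  lift0 (\sum_(i <- r) F i) = \sum_(i <- r) lift0 (F i).
Proof. exact: (big_morph lift0 lift0D lift00). Qed.

Let lift0Z a x : lift0 (a *: x) = a *: lift0 x.
Proof.
have -> : a *: x = fgscale a x by [].
rewrite -[x in RHS]freeg_sumE /fgscale !lift0_sum scaler_sumr.
by apply: eq_bigr => p _; rewrite /lift0 !liftU scalerA.
Qed.

Let lift0_rel x : tensor_rel x -> lift0 x = 0.
Proof.
elim=> [|a y z _ hy _ hz|a u u' v|a u v v'] //.
- by rewrite lift0D lift0Z hy hz scaler0 addr0.
- by rewrite lift0B lift0D lift0Z !lift0U linearPl subrr.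
- by rewrite lift0B lift0D lift0Z !lift0U linearPr subrr.
Qed.

Definition tlift_fun (t : tensor) : W := lift0 (repr t).

Let tlift_class x : tlift_fun (quot_class tensor_ker_submod x) = lift0 x.
Proof.
apply/eqP; rewrite -subr_eq0 -lift0B; apply/eqP/lift0_rel.
suff /asboolP : repr (quot_class tensor_ker_submod x) - x \in tensor_ker by [].
by apply/(quot_classP tensor_ker_submod); apply: quot_reprK.
Qed.

Lemma tlift_linear : linear tlift_fun.
Proof.
move=> a s t; rewrite -[s]quot_reprK -[t]quot_reprK -linearP !tlift_class.
by rewrite lift0D lift0Z.
Qed.

Definition tlift : {linear tensor -> W} := mklinear tlift_linear.

Lemma tliftE u v : tlift (tpure u v) = f u v.
Proof. by rewrite /= tlift_class lift0U. Qed.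

End Lift.

Lemma tensor_ind (P : tensor -> Prop) :
  P 0 -> (forall u v, P (tpure u v)) -> (forall s t, P s -> P t -> P (s + t)) ->
  forall t, P t.
Proof.
move=> P0 Pp PD t; rewrite -[t]quot_reprK -[repr t]freeg_sumE linear_sum.
elim/big_rec: _ => // -[u v] s _ Ps; apply: PD => //.
have -> : forall k, << k *g (u, v) >> = k *: gen u v.
  by move=> k; apply/eqP/freeg_eqP => z; rewrite coeffZ !coeffU mul1r.
rewrite linearZ /=; have <- := linearZl_LR tpure v _ u; exact: Pp.
Qed.

Lemma tensor_ext (W : lmodType K) (f g : {linear tensor -> W}) :
  (forall u v, f (tpure u v) = g (tpure u v)) -> f = g.
Proof.
move=> fg; apply: linear_ext; elim/tensor_ind => [|//|s t hs ht].
  by rewrite !linear0.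
by rewrite !linearD hs ht.
Qed.

End TensorProduct.

Notation "u ⊗ v" := (tpure u v) (at level 40, left associativity) : ring_scope.

Section TensorMaps.
Variable K : fieldType.

Lemma tlift_lin (U V W : lmodType K) (f g h : {bilinear U -> V -> W}) (a : K) :
    (forall u v, f u v = a *: g u v + h u v) ->
  forall t, tlift f t = a *: tlift g t + tlift h t.
Proof.
move=> fgh; elim/tensor_ind => [|u v|s t hs ht].
- by rewrite !linear0 ?scaler0 addr0.
- by rewrite !tliftE.
- by rewrite !linearD hs ht ?scalerDr addrACA.
Qed.

Lemma tmap_bilinear (U V U' V' : lmodType K)
    (f : {linear U -> U'}) (g : {linear V -> V'}) :
  bilinear_for *:%R *:%R (fun u v => f u ⊗ g v).
Proof.
by split=> [v a u u'|u a v v'] /=; rewrite linearP (linearPl, linearPr).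
Qed.

Definition tmap (U V U' V' : lmodType K)
    (f : {linear U -> U'}) (g : {linear V -> V'}) :
    {linear tensor U V -> tensor U' V'} :=
  tlift (mkbilinear (tmap_bilinear f g)).

Lemma tassoc_bilinear1 (U V W : lmodType K) (w : W) :
  bilinear_for *:%R *:%R (fun (u : U) (v : V) => u ⊗ (v ⊗ w)).
Proof.
by split=> [v a u u'|u a v v'] /=; rewrite ?linearPl ?linearPr.
Qed.

Lemma tassoc_bilinear (U V W : lmodType K) :
  bilinear_for *:%R *:%R
    (fun (t : tensor U V) (w : W) => tlift (mkbilinear (@tassoc_bilinear1 U V W w)) t).
Proof.
split=> [w a s t|t a w w']; first exact: linearP.
by apply: tlift_lin => u v /=; rewrite !linearPr.
Qed.

Definition tassoc (U V W : lmodType K) :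
    {linear tensor (tensor U V) W -> tensor U (tensor V W)} :=
  tlift (mkbilinear (@tassoc_bilinear U V W)).

Lemma tassocE (U V W : lmodType K) (u : U) (v : V) (w : W) :
  tassoc U V W ((u ⊗ v) ⊗ w) = u ⊗ (v ⊗ w).
Proof. by rewrite tliftE [LHS]tliftE. Qed.

Lemma tmul_bilinear1 (H : algType K) (a b : H) :
  bilinear_for *:%R *:%R (fun c d : H => (a * c) ⊗ (b * d)).
Proof.
split=> [d k c c'|c k d d'] /=.
  by rewrite mulrDr -scalerAr linearPl.
by rewrite mulrDr -scalerAr linearPr.
Qed.

Lemma tmul_bilinear (H : algType K) (t : tensor H H) :
  bilinear_for *:%R *:%R
    (fun a b : H => tlift (mkbilinear (tmul_bilinear1 a b)) t).
Proof.
split=> [b k a a'|a k b b']; apply: tlift_lin => c d /=.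
  by rewrite mulrDl -scalerAl linearPl.
by rewrite mulrDl -scalerAl linearPr.
Qed.

Definition tmul (H : algType K) (s t : tensor H H) : tensor H H :=
  tlift (mkbilinear (tmul_bilinear t)) s.

Lemma tmulE (H : algType K) (a b c d : H) :
  tmul (a ⊗ b) (c ⊗ d) = (a * c) ⊗ (b * d).
Proof. by rewrite /tmul tliftE [LHS]tliftE. Qed.

Lemma counitl_bilinear (H : lmodType K) (e : {scalar H}) :
  bilinear_for *:%R *:%R (fun x y : H => e x *: y).
Proof.
split=> [y a x x'|x a y y'] /=.
  by rewrite linearP scalerDl scalerA.
by rewrite scalerDr !scalerA mulrC.
Qed.

Lemma counitr_bilinear (H : lmodType K) (e : {scalar H}) :
  bilinear_for *:%R *:%R (fun x y : H => e y *: x).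
Proof.
split=> [y a x x'|x a y y'] /=.
  by rewrite scalerDr !scalerA mulrC.
by rewrite linearP scalerDl scalerA.
Qed.

End TensorMaps.

Record bialgebra (K : fieldType) := Bialgebra {
  bi_alg :> algType K;
  comul : {linear bi_alg -> tensor bi_alg bi_alg};
  counit : {scalar bi_alg};
  comulA : forall x,
    tassoc _ _ _ (tmap comul idEnd (comul x)) = tmap idEnd comul (comul x);
  counitl : forall x, tlift (mkbilinear (counitl_bilinear counit)) (comul x) = x;
  counitr : forall x, tlift (mkbilinear (counitr_bilinear counit)) (comul x) = x;
  comulM : forall x y, comul (x * y) = tmul (comul x) (comul y);
  comul1 : comul 1 = 1 ⊗ 1;
  counitM : forall x y, counit (x * y) = counit x * counit y;
  counit1 : counit 1 = 1
}.
Arguments comul {K b}.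
Arguments counit {K b}.

(* Not assumed unital (nor nonzero), unlike [algType K]. *)
Record assocAlgebra (K : fieldType) := AssocAlgebra {
  alg_mod :> lmodType K;
  amul : {bilinear alg_mod -> alg_mod -> alg_mod};
  amulA : associative amul
}.

Section Sweedler.
Variables (K : fieldType) (H : bialgebra K) (A : assocAlgebra K).
Implicit Types (f g : {linear H -> End A}) (x : H) (a b : A).

Lemma sweedler_bilinear f g a b :
  bilinear_for *:%R *:%R (fun y z : H => amul A (f y a) (g z b)).
Proof.
split=> [z k y y'|y k z z'] /=; rewrite linearP ?linearE.
  by rewrite linearPl.
by rewrite linearPr.
Qed.

(* $\sum_{(x)} f(x_{(1)})(a) \cdot g(x_{(2)})(b)$, well defined because the     *)
(* summand is bilinear in $x_{(1)}, x_{(2)}$.                                 *)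
Definition sweedler f g x a b : A :=
  tlift (mkbilinear (sweedler_bilinear f g a b)) (comul x).

Lemma sweedler_lin f g x : bilinear_for *:%R *:%R (sweedler f g x).
Proof.
split=> [b k a a'|a k b b']; apply: tlift_lin => y z /=; rewrite linearP.
  by rewrite linearPl.
by rewrite linearPr.
Qed.

Lemma sweedler_linx f g a b : linear (fun x => sweedler f g x a b).
Proof. by move=> k x y; rewrite /sweedler !linearP. Qed.

Lemma sweedler_linf g x a b : linear (fun f => sweedler f g x a b).
Proof.
by move=> k f f'; apply: tlift_lin => y z /=; rewrite ?linearE linearPl.
Qed.

Lemma sweedler_ling f x a b : linear (fun g => sweedler f g x a b).
Proof.
by move=> k g g'; apply: tlift_lin => y z /=; rewrite ?linearE linearPr.
Qed.

End Sweedler.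

(* No condition on the action of [1 : H] is imposed.                          *)
Record moduleAlgebra (K : fieldType) (H : bialgebra K) := ModuleAlgebra {
  ma_alg :> assocAlgebra K;
  action : {linear H -> End ma_alg};
  actionM : forall x y, action (x * y) = comp_lin (action x) (action y);
  action_amul : forall x a b,
    action x (amul ma_alg a b) = sweedler action action x a b
}.

Lemma comb_B (K : fieldType) (V : lmodType K) (k : K) (p p' q q' : V) :
  (k *: p + p') - (k *: q + q') = k *: (p - q) + (p' - q').
Proof. by rewrite scalerBr opprD addrACA. Qed.

Lemma comb_D (K : fieldType) (V : lmodType K) (k : K) (p p' q q' : V) :
  (k *: p + p') + (k *: q + q') = k *: (p + q) + (p' + q').
Proof. by rewrite scalerDr addrACA. Qed.

Section Complex.
Variables (K : fieldType) (H : bialgebra K) (A : moduleAlgebra H).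
Local Notation lam := (action A).
Local Notation "a ** b" := (amul A a b) (at level 40, left associativity).

Definition is_derivation : {pred End A} :=
  fun phi => `[< forall a b, phi (a ** b) = phi a ** b + a ** phi b >].

Lemma derivation_submod : submod_closed is_derivation.
Proof.
split=> [|k f g /asboolP df /asboolP dg]; apply/asboolP => a b.
  by rewrite ?linearE linear0l linear0r addr0.
by rewrite ?linearE df dg linearPl linearPr scalerDr addrACA.
Qed.
HB.instance Definition _ := GRing.isSubmodClosed.Build K (End A) is_derivation
  (GRing.submod_closed_semi derivation_submod).

Definition derivation := {phi : End A | is_derivation phi}.
HB.instance Definition _ := SubType.on derivation.
HB.instance Definition _ := Choice.on derivation.
HB.instance Definition _ := [SubChoice_isSubLmodule of derivation by <:].

Definition F0 : lmodType K := derivation.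

Definition der (phi : F0) : End A := val (phi : derivation).

Lemma derP phi a b : der phi (a ** b) = der phi a ** b + a ** der phi b.
Proof. by have /asboolP := valP (phi : derivation); apply. Qed.

Definition F1 : lmodType K := {linear H -> End A}.

Definition F2 : lmodType K :=
  ({linear tensor H H -> End A} * {linear H -> {linear tensor A A -> A}})%type.

Lemma d0_linear1 (phi : F0) :
  linear (fun x => comp_lin (lam x) (der phi) - comp_lin (der phi) (lam x)).
Proof.
move=> k x y; apply: linear_ext => a /=.
by rewrite (linearP lam) /= (linearP (der phi)) comb_B.
Qed.

Lemma d0_linear : linear (fun phi => mklinear (d0_linear1 phi) : F1).
Proof.
move=> k f g; apply: linear_ext => x; apply: linear_ext => a /=.
by rewrite (linearP (lam x)) comb_B.
Qed.

Definition d0 : {linear F0 -> F1} := mklinear d0_linear.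

Lemma d1_0_bilinear (psi : F1) :
  bilinear_for *:%R *:%R (fun x y : H =>
    comp_lin (lam x) (psi y) - psi (x * y) + comp_lin (psi x) (lam y)).
Proof.
split=> [y k x x'|x k y y']; apply: linear_ext => a /=.
  rewrite mulrDl -scalerAl (linearP lam) !(linearP psi) /=.
  by rewrite comb_B comb_D.
rewrite mulrDr -scalerAr (linearP lam) !(linearP psi) /=.
by rewrite (linearP (lam x)) (linearP (psi x)) comb_B comb_D.
Qed.

Definition d1_0 (psi : F1) : {linear tensor H H -> End A} :=
  tlift (mkbilinear (d1_0_bilinear psi)).

Lemma d1_1_bilinear (psi : F1) (x : H) :
  bilinear_for *:%R *:%R (fun a b : A =>
    sweedler lam psi x a b - psi x (a ** b) + sweedler psi lam x a b).
Proof.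
split=> [b k a a'|a k b b'].
  rewrite !(sweedler_lin _ _ _).1 linearPl (linearP (psi x)).
  by rewrite comb_B comb_D.
rewrite !(sweedler_lin _ _ _).2 linearPr (linearP (psi x)).
by rewrite comb_B comb_D.
Qed.

Lemma d1_1_linear (psi : F1) :
  linear (fun x => tlift (mkbilinear (d1_1_bilinear psi x))).
Proof.
move=> k x y; apply: tensor_ext => a b.
cbv beta; rewrite linDE linZE.
rewrite !tliftE /= !(sweedler_linx _ _ _ _ k x y).
by rewrite (linearP psi) /= comb_B comb_D.
Qed.

Definition d1_1 (psi : F1) : {linear H -> {linear tensor A A -> A}} :=
  mklinear (d1_1_linear psi).

Lemma d1_0E psi x y :
  d1_0 psi (x ⊗ y) =
  comp_lin (lam x) (psi y) - psi (x * y) + comp_lin (psi x) (lam y).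
Proof. exact: tliftE. Qed.

Lemma d1_1E psi x a b :
  d1_1 psi x (a ⊗ b) =
  sweedler lam psi x a b - psi x (a ** b) + sweedler psi lam x a b.
Proof. exact: tliftE. Qed.

Lemma d1_0_linear : linear d1_0.
Proof.
move=> k f g; apply: tensor_ext => x y; apply: linear_ext => a.
by rewrite linDE linZE !d1_0E /= (linearP (lam x)) comb_B comb_D.
Qed.

Lemma d1_1_linear2 : linear d1_1.
Proof.
move=> k f g; apply: linear_ext => x; apply: tensor_ext => a b.
rewrite linDE !linZE !d1_1E [sweedler lam _ _ _ _](sweedler_ling lam x a b k f g).
by rewrite [sweedler _ lam _ _ _](sweedler_linf lam x a b k f g) linDE linZE comb_B comb_D.
Qed.

Lemma d1_linear : linear (fun psi => (d1_0 psi, d1_1 psi) : F2).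
Proof.
by move=> k f g; apply: (congr2 pair (d1_0_linear k f g) (d1_1_linear2 k f g)).
Qed.

Definition d1 : {linear F1 -> F2} := mklinear d1_linear.

Lemma sweedler_d0 phi x a b :
  sweedler lam (d0 phi) x a b + sweedler (d0 phi) lam x a b =
  sweedler lam lam x a (der phi b) + sweedler lam lam x (der phi a) b
    - der phi (sweedler lam lam x a b).
Proof.
rewrite /sweedler; elim/tensor_ind: (comul x) => [|y z|s t hs ht].
- by rewrite !linear0 ?oppr0 ?addr0.
- rewrite !tliftE /= derP linearBr linearBl opprD addrACA.
  by congr (_ + _); rewrite addrC.
- rewrite !linearD addrACA hs ht [LHS]addrACA; congr (_ + _).
  by rewrite addrACA.
Qed.

Lemma d1_d0 phi : d1 (d0 phi) = 0.
Proof.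
apply: (congr2 pair (_ : d1_0 (d0 phi) = 0) (_ : d1_1 (d0 phi) = 0)).
  apply: tensor_ext => x y; apply: linear_ext => a.
  rewrite d1_0E !linearE /= !actionM /= (linearB (lam x)).
  by rewrite opprB [X in X + _]addrC [X in X + _]addrA subrK addrA subrK subrr.
apply: linear_ext => x; apply: tensor_ext => a b.
rewrite d1_1E addrAC sweedler_d0 -!action_amul /=.
rewrite derP (linearD (lam x)) [_ (_ ** _) + _]addrC opprB addrA subrK.
by rewrite subrr.
Qed.

Definition is_cocycle : {pred F1} := fun psi => d1 psi == 0.

Lemma cocycle_submod : submod_closed is_cocycle.
Proof.
split=> [|k f g /eqP df /eqP dg]; apply/eqP; first by rewrite linear0.
by rewrite linearP df dg scaler0 addr0.
Qed.
HB.instance Definition _ := GRing.isSubmodClosed.Build K F1 is_cocycle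
  (GRing.submod_closed_semi cocycle_submod).

Definition cocycle := {psi : F1 | is_cocycle psi}.
HB.instance Definition _ := SubType.on cocycle.
HB.instance Definition _ := Choice.on cocycle.
HB.instance Definition _ := [SubChoice_isSubLmodule of cocycle by <:].

(* By [d1_d0] every [d0 phi] is a cocycle, so this is exactly im d0.          *)
Definition is_coboundary : {pred cocycle} :=
  fun psi => `[< exists phi : F0, val psi = d0 phi >].

Lemma coboundary_submod : submod_closed is_coboundary.
Proof.
split=> [|k f g /asboolP[p fp] /asboolP[q gq]]; apply/asboolP.
  by exists 0; rewrite (linear0 d0) raddf0.
by exists (k *: p + q); rewrite (linearP d0) -fp -gq linearP.
Qed.

Definition H1 : lmodType K := quotmod coboundary_submod.

Definition cohomology_class (psi : cocycle) : H1 :=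
  quot_class coboundary_submod psi.

End Complex.

(* A power series $\sum_n f_n t^n$ over a vector space [V] is given by its    *)
(* coefficient sequence [f : nat -> V].                                       *)
Definition series_mul (K : fieldType) (U V W : lmodType K) (op : U -> V -> W)
    (f : nat -> U) (g : nat -> V) (n : nat) : W :=
  \sum_(i < n.+1) op (f i) (g (n - i)%N).

Section EndSeries.
Variables (K : fieldType) (A : lmodType K).
Implicit Types P Q S : nat -> End A.

Definition series_comp P Q : nat -> End A :=
  series_mul (@comp_lin K A A A) P Q.

Definition series_id : nat -> End A := fun n => if n is 0 then idEnd else 0.

Fixpoint series_inv_upto P (n : nat) : seq (End A) :=
  if n is m.+1 then
    let s := series_inv_upto P m in
    rcons s (- \sum_(i < m.+1) comp_lin s`_i (P (m.+1 - i)%N))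
  else [:: idEnd].

(* The recursion solves [series_comp (series_inv P) P = series_id] degree by  *)
(* degree, so it is the inverse only when [P 0 = idEnd].                      *)
Definition series_inv P (n : nat) : End A := (series_inv_upto P n)`_n.

Lemma size_series_inv_upto P n : size (series_inv_upto P n) = n.+1.
Proof. by elim: n => //= n IHn; rewrite size_rcons IHn. Qed.

Lemma nth_series_inv_upto P n i :
  (i <= n)%N -> (series_inv_upto P n)`_i = series_inv P i.
Proof.
elim: n => [|n IHn]; first by rewrite leqn0 => /eqP ->.
rewrite leq_eqVlt => /orP[/eqP -> //|lt_in] /=.
by rewrite nth_rcons size_series_inv_upto lt_in IHn.
Qed.

Lemma series_invS P n : series_inv P n.+1 =
  - \sum_(i < n.+1) comp_lin (series_inv P i) (P (n.+1 - i)%N).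
Proof.
rewrite /series_inv /= nth_rcons size_series_inv_upto ltnn eqxx.
by congr (- _); apply: eq_bigr => i _; rewrite nth_series_inv_upto // -ltnS.
Qed.

Lemma comp_id (f : End A) : comp_lin f idEnd = f.
Proof. exact: linear_ext. Qed.

Lemma id_comp (f : End A) : comp_lin idEnd f = f.
Proof. exact: linear_ext. Qed.

Lemma comp0 (f : End A) : comp_lin f (0 : End A) = 0.
Proof. by apply: linear_ext => a; apply: linear0. Qed.

Lemma comp_suml (I : finType) (F : I -> End A) (g : End A) :
  comp_lin (\sum_i F i) g = \sum_i comp_lin (F i) g.
Proof. by apply: linear_ext => a; rewrite /= !lin_sumE. Qed.

Lemma comp_sumr (I : finType) (F : I -> End A) (g : End A) :
  comp_lin g (\sum_i F i) = \sum_i comp_lin g (F i).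
Proof. by apply: linear_ext => a; rewrite /= !lin_sumE linear_sum. Qed.

Lemma series_invl P : P 0%N = idEnd ->
  forall n, series_comp (series_inv P) P n = series_id n.
Proof.
move=> P0 [|n]; rewrite /series_comp /series_mul big_ord_recr /=.
  by rewrite big_ord0 add0r P0 comp_id.
by rewrite subnn P0 comp_id series_invS addrN.
Qed.

Lemma series_compA P Q S n :
  series_comp P (series_comp Q S) n = series_comp (series_comp P Q) S n.
Proof.
rewrite /series_comp /series_mul.
under eq_bigr do rewrite comp_sumr.
under [RHS]eq_bigr do rewrite comp_suml.
pose G i k := comp_lin (comp_lin (P i) (Q (k - i)%N)) (S (n - k)%N).
transitivity (\sum_(i < n.+1) \sum_(k < n.+1 | (i <= k)%N) G i k); last first.
  rewrite (exchange_big_dep xpredT) //=; apply: eq_bigr => k _.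
  rewrite (big_ord_widen _ (G^~ k) (ltn_ord k)).
  by apply: eq_bigl => i; rewrite ltnS.
apply: eq_bigr => i _; have le_in : (i <= n)%N by rewrite -ltnS.
rewrite -(big_geq_mkord i n.+1 xpredT (G i)).
rewrite [RHS](_ : _ = \sum_(0 + i <= k < n.+1) G i k) //.
rewrite big_addn subSn // big_mkord; apply: eq_bigr => j _.
rewrite /G addnK subnDA subnAC; exact: linear_ext.
Qed.

Lemma series_idl P n : series_comp series_id P n = P n.
Proof.
rewrite /series_comp /series_mul big_ord_recl subn0 id_comp big1 ?addr0 //.
by move=> i _; apply: linear_ext.
Qed.

Lemma series_idr P n : series_comp P series_id n = P n.
Proof.
rewrite /series_comp /series_mul big_ord_recr /= subnn comp_id big1 ?add0r //.
by move=> i _; rewrite -[(n - i)%N]prednK ?subn_gt0 //= comp0.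
Qed.

Lemma series_invr P : P 0%N = idEnd ->
  forall n, series_comp P (series_inv P) n = series_id n.
Proof.
move=> P0; set Q := series_inv P; pose S := series_inv Q.
have QP : series_comp Q P = series_id by apply: funext; apply: series_invl.
have SQ : series_comp S Q = series_id by apply: funext; apply: series_invl.
suff -> : P = S by move=> n; rewrite SQ.
apply: funext => n.
by rewrite -[LHS]series_idl -SQ -series_compA QP series_idr.
Qed.

End EndSeries.

Section Deformations.
Variables (K : fieldType) (H : bialgebra K) (A : moduleAlgebra H).

Definition deformation (L : nat -> F1 A) : Prop :=
  [/\ L 0%N = action A,
      forall x y n, L n (x * y) = series_comp (L^~ x) (L^~ y) n
    & forall x a b n,
        L n x (amul A a b) =
        series_mul (fun f g : F1 A => sweedler f g x a b) L L n].

Definition infinitesimal (L : nat -> F1 A) : F1 A := L 1%N.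

Definition formal_automorphism (P : nat -> End A) : Prop :=
  P 0%N = idEnd /\
  forall a b n, P n (amul A a b) = series_mul (amul A) (P^~ a) (P^~ b) n.

Definition equivalent (L L' : nat -> F1 A) : Prop :=
  exists2 P, formal_automorphism P &
    forall x n, L' n x = series_comp (series_comp (series_inv P) (L^~ x)) P n.

End Deformations.

(* Main.v *)
Require Import Defs.
From mathcomp Require Import all_boot all_algebra.
From mathcomp Require Import boolp.
Set Implicit Arguments.
Unset Strict Implicit.
Unset Printing Implicit Defensive.
Import GRing.Theory.
Local Open Scope ring_scope.

(* The coefficient of t^(k+1) in a product of series whose left factor has no *)
(* terms of degree 1, ..., k is f_0 g_(k+1) + f_(k+1) g_0.  Applied to the two *)
(* deformation equations it gives d1 lambda_(k+1) = 0.  If Phi = 1 + p t + ... *)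
(* conjugates L into L', then p is a derivation and the coefficient of t in   *)
(* Phi^-1 L Phi is lambda_1 + lambda p - p lambda = lambda_1 + d0 p.          *)

(** The components of [d1] linearize the two deformation equations at [action A], so the coefficient
    following a run of vanishing corrections is killed by [d1] ([deformation_gap_cocycle]). Likewise
    [d0] linearizes conjugation by a formal automorphism, so equivalence moves the infinitesimal by
    a coboundary ([infinitesimal_equivalent]). *)

Lemma series_mul_gap (K : fieldType) (U V W : lmodType K) (op : U -> V -> W)
    (f : nat -> U) (g : nat -> V) (k : nat) :
  (forall v, op 0 v = 0) -> (forall i, (1 <= i <= k)%N -> f i = 0) ->
  series_mul op f g k.+1 = op (f 0%N) (g k.+1) + op (f k.+1) (g 0%N).
Proof.
move=> op0 f0; rewrite /series_mul big_ord_recl big_ord_recr /= subnn subn0.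
rewrite big1 ?add0r // => i _.
by rewrite f0 ?op0 // /bump add1n ltn_ord.
Qed.

Lemma series_mul1 (K : fieldType) (U V W : lmodType K) (op : U -> V -> W)
    (f : nat -> U) (g : nat -> V) :
  series_mul op f g 1 = op (f 0%N) (g 1%N) + op (f 1%N) (g 0%N).
Proof. by rewrite /series_mul big_ord_recl big_ord1. Qed.

Section Deformations.
Variables (K : fieldType) (H : bialgebra K) (A : moduleAlgebra H).
Implicit Types (L : nat -> F1 A) (P : nat -> End A).

Lemma deformation_gap_cocycle L k : deformation L ->
  (forall i, (1 <= i <= k)%N -> L i = 0) -> d1 A (L k.+1) = 0.
Proof.
move=> [L0 LM Lmul] gap.
apply: (congr2 pair (_ : d1_0 (L k.+1) = 0) (_ : d1_1 (L k.+1) = 0)).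
  apply: tensor_ext => x y; rewrite d1_0E LM /series_comp series_mul_gap.
  - by rewrite L0 opprD addrA subrr sub0r addNr.
  - by move=> f; apply: linear_ext.
  - by move=> i /gap ->.
apply: linear_ext => x; apply: tensor_ext => a b.
rewrite d1_1E Lmul series_mul_gap //.
- by rewrite L0 opprD addrA subrr sub0r addNr.
(* The Sweedler product is linear in its first map, hence vanishes when that map is 0. *)
- by move=> g; exact: (linear0 (mklinear (sweedler_linf g x a b))).
Qed.

(** Since [P 0] is the identity, the coefficient of t in multiplicativity is the Leibniz rule. *)
Lemma formal_automorphism_derivation P :
  formal_automorphism P -> is_derivation (P 1%N : End A).
Proof.
move=> [P0 Pmul]; apply/asboolP => a b.
by rewrite Pmul series_mul1 P0 addrC.
Qed.

Lemma series_inv1 P : P 0%N = idEnd -> series_inv P 1 = - P 1%N.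
Proof. by move=> P0; rewrite series_invS big_ord1 id_comp. Qed.

Lemma infinitesimal_equivalent L L' : L 0%N = action A -> equivalent L L' ->
  exists phi : F0 A, infinitesimal L' = infinitesimal L + d0 A phi.
Proof.
move=> L0 [P autP conj]; exists (Sub (P 1%N) (formal_automorphism_derivation autP)).
have [P0 _] := autP.
apply: linear_ext => x; rewrite /infinitesimal conj /series_comp !series_mul1.
rewrite series_inv1 // P0 comp_id.
(* The constant term of [series_inv P] is [idEnd] by computation. *)
rewrite [series_mul _ _ _ 0%N]big_ord1 !id_comp L0.
apply: linear_ext => a; rewrite /der /= addrC -addrA; congr (_ + _).
by rewrite addrC.
Qed.

End Deformations.

Theorem theorem3p3 (K : fieldType) (H : bialgebra K) (A : moduleAlgebra H)
    (L : nat -> F1 A) (defL : deformation L) :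
  [/\ d1 A (infinitesimal L) = 0,
      forall L' : nat -> F1 A, deformation L' -> equivalent L L' ->
        forall z z' : cocycle A,
          val z = infinitesimal L -> val z' = infinitesimal L' ->
          cohomology_class z = cohomology_class z'
    & forall k : nat, (forall i : nat, (1 <= i <= k)%N -> L i = 0) ->
        d1 A (L k.+1) = 0].
Proof.
split=> [|L' _ eqL z z' zL zL'|k]; last exact: deformation_gap_cocycle.
  (* This is the case k = 0, where no index satisfies the gap condition. *)
  by apply: deformation_gap_cocycle => // i /andP[/lt0n_neq0/negbTE]; case: i.
have [L0 _ _] := defL; have [phi L'E] := infinitesimal_equivalent L0 eqL.
(* The sign comes from z - z' being [infinitesimal L - infinitesimal L']. *)
apply/quot_classP/asboolP; exists (- phi).
rewrite (linearN (d0 A)) raddfB /=.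
by rewrite zL zL' L'E opprD addrA subrr sub0r.
Qed.
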